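(* Let $0<b\le\infty$, let $\Phi:[0,b)\to[0,\infty)$, and let $f:[0,b)\to\mathbb{R}$ be a continuously differentiable $\Phi$-uniformly convex function. Let $\mathbf{x}=(x_1,\dots,x_n)\in[0,b)^n$, and let $\mathbf{p}=(p_1,\dots,p_n)$ and $\mathbf{q}=(q_1,\dots,q_n)$ be non-negative $n$-tuples with $\sum_{i=1}^{n}p_i=1$, $\sum_{i=1}^{n}q_i=1$ and $q_i>0$ for $i=1,\dots,n$. Put $$m=\min_{1\le i\le n}\frac{p_i}{q_i},\qquad M=\max_{1\le i\le n}\frac{p_i}{q_i},\qquad \overline{x}_p=\sum_{j=1}^{n}p_jx_j,\qquad \overline{x}_q=\sum_{j=1}^{n}q_jx_j.$$ Then $$J_n(f,\mathbf{x},\mathbf{p})-mJ_n(f,\mathbf{x},\mathbf{q})\ge m\Phi(|\overline{x}_q-\overline{x}_p|)+\sum_{i=1}^{n}(p_i-mq_i)\Phi(|x_i-\overline{x}_p|)\qquad(\mathrm{A})$$ and $$MJ_n(f,\mathbf{x},\mathbf{q})-J_n(f,\mathbf{x},\mathbf{p})\ge\sum_{i=1}^{n}(Mq_i-p_i)\Phi(|x_i-\overline{x}_q|)+\Phi(|\overline{x}_q-\overline{x}_p|).\qquad(\mathrm{B})$$ In the special case that $n=2$ and $m=\frac{p_1}{q_1}$, $$J_2(f,\mathbf{x},\mathbf{p})-\frac{p_1}{q_1}J_2(f,\mathbf{x},\mathbf{q})\ge\frac{p_1}{q_1}\Phi(|\overline{x}_q-\overline{x}_p|)+\left(p_2-\frac{p_1}{q_1}q_2\right)\Phi(p_1|x_2-x_1|)$$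 $$=m\Phi(|\overline{x}_q-\overline{x}_p|)+(1-m)\Phi(p_1|x_2-x_1|)\qquad(\mathrm{C})$$ and $$\frac{p_2}{q_2}J_2(f,\mathbf{x},\mathbf{q})-J_2(f,\mathbf{x},\mathbf{p})\ge\left(\frac{p_2}{q_2}q_1-p_1\right)\Phi(|q_2(x_2-x_1)|)+\Phi(|\overline{x}_q-\overline{x}_p|).\qquad(\mathrm{D})$$ When moreover (still with $n=2$ and $m=\frac{p_1}{q_1}$) $q_1=q_2=\frac12$, $$J_2(f,\mathbf{x},\mathbf{p})-2p_1\left(\frac{f(x_1)+f(x_2)}{2}-f\left(\frac{x_1+x_2}{2}\right)\right)\ge 2p_1\Phi\left(\left|\frac{x_1+x_2}{2}-\overline{x}_p\right|\right)+(1-2p_1)\Phi(p_1|x_2-x_1|)\qquad(\mathrm{E})$$ and $$\frac{p_2}{q_2}\left(\frac{f(x_1)+f(x_2)}{2}-f\left(\frac{x_1+x_2}{2}\right)\right)-J_2(f,\mathbf{x},\mathbf{p})\ge(p_2-p_1)\Phi\left(\left|\frac{x_2-x_1}{2}\right|\right)+\Phi\left(\left|\frac{x_1+x_2}{2}-\overline{x}_p\right|\right).\qquad(\mathrm{F})$$ In the special case $f(x)=\Phi(x)=x^2$, $x\ge 0$, equality holds in (A), (B), (C), (D), (E) and (F).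
   Context: The Jensen functional is $J_n(f,\mathbf{x},\mathbf{p})=\sum_{i=1}^{n}p_if(x_i)-f\left(\sum_{i=1}^{n}p_ix_i\right)$. A function $f:[0,b)\to\mathbb{R}$ is $\Phi$-uniformly convex, where $\Phi:[0,b)\to\mathbb{R}$ and $\Phi\ge 0$, if $tf(x)+(1-t)f(y)\ge f(tx+(1-t)y)+t(1-t)\Phi(|x-y|)$ for all $x,y\in[0,b)$ and $t\in[0,1]$. *)

(* Defs.v *)
From HB Require Import structures.
From mathcomp Require Import all_boot all_order all_algebra.
From mathcomp Require Import all_classical all_reals all_analysis.
Set Implicit Arguments.
Unset Strict Implicit.
Unset Printing Implicit Defensive.
Import Order.TTheory GRing.Theory Num.Theory numFieldNormedType.Exports.
Local Open Scope classical_set_scope.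
Local Open Scope ring_scope.

(** A function on [[0, b)] is represented by a total
    function [R -> R] about which nothing is assumed outside [[0, b)]. *)

Section Defs.
Context {R : realType}.

(** [b] is an extended real so that [b = +oo] is allowed. *)
Definition halfopen (b : \bar R) : set R := [set x | 0 <= x /\ (x%:E < b)%E].

(** The difference quotient is taken within [A], so on [[0, b)] the derivative
    is one-sided at [0] and two-sided elsewhere. *)
Definition continuously_differentiable_on (A : set R) (f : R -> R) : Prop :=
  exists df : R -> R,
    (forall x, A x ->
       (fun y => (f y - f x) / (y - x)) @ within A x^' --> df x) /\
    {within A, continuous df}.

Definition uniformly_convex (b : \bar R) (Phi f : R -> R) : Prop :=
  forall x y t : R, halfopen b x -> halfopen b y -> 0 <= t <= 1 ->
    t * f x + (1 - t) * f y >=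
    f (t * x + (1 - t) * y) + t * (1 - t) * Phi `|x - y|.

Definition wmean n (x p : 'I_n -> R) : R := \sum_(i < n) p i * x i.

Definition jensen n (f : R -> R) (x p : 'I_n -> R) : R :=
  \sum_(i < n) p i * f (x i) - f (wmean x p).

(** The neutral element of each fold is one of the ratios, so that the folds
    are the exact minimum and maximum. *)
Definition min_ratio n (p q : 'I_n.+1 -> R) : R :=
  \big[Num.min/p ord0 / q ord0]_(i < n.+1) (p i / q i).
Definition max_ratio n (p q : 'I_n.+1 -> R) : R :=
  \big[Num.max/p ord0 / q ord0]_(i < n.+1) (p i / q i).

Definition admissible n (b : \bar R) (x p q : 'I_n -> R) : Prop :=
  [/\ forall i, halfopen b (x i),
      forall i, 0 <= p i,
      forall i, 0 < q i,
      \sum_(i < n) p i = 1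
    & \sum_(i < n) q i = 1].

End Defs.

(* Main.v *)
(** Letting [t -> 0+] in the definition of uniform convexity gives, at every [c],
    the support inequality [f y >= f c + f'(c) (y - c) + Phi |y - c|].  The
    difference of the two sides of (A) is the sum of the defects of this
    inequality at [c = xp] over the points [x i] and [xq], with nonnegative
    weights [p i - m q i] and [m]; for (B) take [c = xq], the points [x i] and
    [xp], and the weights [M q i - p i] and [1].  The slope terms cancel because
    [c] is the barycentre.  For [f = Phi = square] every defect vanishes. *)
Require Import Defs.
From HB Require Import structures.
From mathcomp Require Import all_boot all_order all_algebra.
From mathcomp Require Import all_classical all_reals all_analysis.
From mathcomp Require Import ring lra.
Set Implicit Arguments.
Unset Strict Implicit.
Unset Printing Implicit Defensive.
Import Order.TTheory GRing.Theory Num.Theory numFieldNormedType.Exports.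
Local Open Scope classical_set_scope.
Local Open Scope ring_scope.

(** * The support inequality on [0, b) and its defect *)

Section Support.
Context {R : realType}.
Implicit Types (b : \bar R) (f Phi : R -> R).

(** The slope [s] is left free: the gap identities below hold for any [s], and only the sign of the
    defect depends on choosing f'(c). *)
Definition support_defect f Phi (c s y : R) : R :=
  f y - f c - s * (y - c) - Phi `|y - c|.

Lemma halfopen_le b (y z : R) : halfopen b y -> 0 <= z <= y -> halfopen b z.
Proof.
move=> [_ yb] /andP[z0 zy]; split=> //.
by apply: le_lt_trans yb; rewrite lee_fin.
Qed.

(** Both points are nonnegative, so their distance is at most the larger one. Hence [Phi] is
    evaluated inside [0, b), the only place where its values are prescribed. *)
Lemma halfopen_dist b (y z : R) :
  halfopen b y -> halfopen b z -> halfopen b `|y - z|.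
Proof.
move=> hy hz; have [y0 _] := hy; have [z0 _] := hz.
have [zy|/ltW yz] := leP z y.
- by apply: (halfopen_le hy); rewrite ger0_norm; lra.
- by apply: (halfopen_le hz); rewrite ler0_norm; lra.
Qed.

Lemma halfopen_segment b (y z t : R) : halfopen b y -> halfopen b z ->
  0 <= t <= 1 -> halfopen b (y + t * (z - y)).
Proof.
move=> hy hz /andP[t0 t1]; have [y0 _] := hy; have [z0 _] := hz.
have [zy|/ltW yz] := leP z y.
- by apply: (halfopen_le hy); nra.
- by apply: (halfopen_le hz); nra.
Qed.

(** The mean is at most the largest entry, which is itself in [0, b); this gives the strict bound by
    [b] for finite and infinite [b] alike. *)
Lemma halfopen_wmean b n (x p : 'I_n.+1 -> R) :
  (forall i, halfopen b (x i)) -> (forall i, 0 <= p i) ->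
  \sum_(i < n.+1) p i = 1 -> halfopen b (wmean x p).
Proof.
move=> hx p0 p1; pose k := [arg max_(i > ord0) x i]%O.
have xk i : x i <= x k by rewrite /k; case: arg_maxP => // j _; apply.
apply: (halfopen_le (hx k)); rewrite /wmean; apply/andP; split.
  by apply: sumr_ge0 => i _; apply: mulr_ge0; rewrite ?p0 //; case: (hx i).
rewrite -[leRHS]mul1r -p1 mulr_suml; apply: ler_sum => i _.
by rewrite ler_wpM2l.
Qed.

Lemma support_defect_ge0 b f Phi (df : R -> R) (c y : R) :
  uniformly_convex b Phi f ->
  (fun z => (f z - f c) / (z - c)) @ within (halfopen b) c^' --> df c ->
  halfopen b c -> halfopen b y -> 0 <= support_defect f Phi c (df c) y.
Proof.
move=> uc dfc hc hy; rewrite /support_defect.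
(* No difference quotient is available at [y = c]. There the claim is [Phi 0 <= 0], which is
   convexity at the pair (c, c) with t = 1/2. *)
have [->|yc] := eqVneq y c.
  have := uc c c (1/2) hc hc; rewrite subrr normr0.
  have -> : 1/2 * c + (1 - 1/2) * c = c by field.
  have t01 : 0 <= (1/2 : R) <= 1 by lra.
  by move/(_ t01); lra.
have d0 : y - c != 0 by rewrite subr_eq0.
pose g (t : R) := c + t * (y - c).
have g0 : g @ 0^'+ --> c.
  apply: cvg_within_filter.
  suff : g @ (0 : R) --> c + 0 * (y - c) by rewrite mul0r addr0.
  by apply: cvgD; [exact: cvg_cst | apply: cvgMl; exact: cvg_id].
(* The derivative is a limit within [0, b) punctured at [c], so the path [g] must stay in [0, b) and
   avoid [c]; both hold for 0 < t <= 1. *)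
have gw : g @ 0^'+ --> within (halfopen b) c^'.
  move=> P; rewrite /within /= => Pc; have {}Pc := g0 _ Pc.
  change (\forall t \near 0^'+, P (g t)); near=> t.
  have t0 : 0 < t by near: t; exact: nbhs_right_gt.
  have t1 : t <= 1 by near: t; exact: nbhs_right_le.
  have gt : g t != c by rewrite /g -subr_eq0 addrC addKr mulf_neq0 // gt_eqF.
  have hg : halfopen b (g t).
    by apply: halfopen_segment => //; rewrite (ltW t0).
  suff : g t != c -> halfopen b (g t) -> P (g t) by exact.
  by near: t; exact: Pc.
(* This is the convexity inequality for (y, c) divided by [t], with (f (g t) - f c) / t written
   through the difference quotient at [g t], whose limit is known. *)
have lim1 : (fun t => (f (g t) - f c) / (g t - c) * (y - c)
    + (1 - t) * Phi `|y - c|) @ 0^'+ --> df c * (y - c) + (1 - 0) * Phi `|y - c|.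
  apply: cvgD; first by apply: cvgMl; exact: (cvg_comp _ _ gw dfc).
  apply: cvgMl; apply: cvgB; first exact: cvg_cst.
  by apply: cvg_within_filter; exact: cvg_id.
suff : df c * (y - c) + (1 - 0) * Phi `|y - c| <= f y - f c by lra.
apply: (cvgr_to_le lim1); near=> t.
have t0 : 0 < t by near: t; exact: nbhs_right_gt.
have t1 : t <= 1 by near: t; exact: nbhs_right_le.
have := uc y c t hy hc; rewrite (ltW t0) t1 => /(_ isT).
have -> : t * y + (1 - t) * c = g t by rewrite /g; ring.
have -> : (f (g t) - f c) / (g t - c) * (y - c) = (f (g t) - f c) / t.
  have -> : g t - c = t * (y - c) by rewrite /g; ring.
  by field; rewrite d0 gt_eqF.
move=> h; rewrite -(ler_pM2l t0) mulrDr mulrCA divff ?gt_eqF // mulr1; lra.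
Unshelve. all: by end_near. Qed.

(** For the square with slope 2c, the gap above the tangent is exactly (y - c)^2, which is the [Phi]
    term. *)
Lemma support_defect_sqr b f Phi (c y : R) :
  (forall t, halfopen b t -> f t = t ^+ 2) ->
  (forall t, halfopen b t -> Phi t = t ^+ 2) ->
  halfopen b c -> halfopen b y -> support_defect f Phi c (2 * c) y = 0.
Proof.
move=> fE PhiE hc hy; rewrite /support_defect !fE // PhiE; last first.
  exact: halfopen_dist.
by rewrite real_normK ?num_real //; ring.
Qed.

(** * Jensen gaps as weighted sums of defects *)

Section Barycentre.
Variables (n : nat) (x p q : 'I_n -> R) (f Phi : R -> R).
Hypotheses (p1 : \sum_(i < n) p i = 1) (q1 : \sum_(i < n) q i = 1).

(** The base point and slope enter only through the total weight and the first moment of [a], the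
    two quantities that the gap identities then evaluate. *)
Lemma sum_support_defect (a : 'I_n -> R) (c s : R) :
  \sum_(i < n) a i * support_defect f Phi c s (x i) =
  \sum_(i < n) a i * f (x i) - (f c - s * c) * \sum_(i < n) a i - s * wmean x a
  - \sum_(i < n) a i * Phi `|x i - c|.
Proof.
rewrite /wmean !mulr_sumr -!sumrB; apply: eq_bigr => i _.
by rewrite /support_defect; ring.
Qed.

Lemma sum_lincomb (u v : R) (F : 'I_n -> R) :
  \sum_(i < n) (u * p i + v * q i) * F i =
  u * \sum_(i < n) p i * F i + v * \sum_(i < n) q i * F i.
Proof. by rewrite !mulr_sumr -big_split /=; apply: eq_bigr => i _; ring. Qed.

(** The weights [p i - m * q i] at [x i] and [m] at [wmean x q] have total 1 and barycentre
    [wmean x p], so the [s] terms cancel. As an identity in arbitrary [m] and [s], it serves both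
    the inequality and the equality case. *)
Lemma jensen_gap_lower (m s : R) :
  jensen f x p - m * jensen f x q =
  m * Phi `|wmean x q - wmean x p|
  + \sum_(i < n) (p i - m * q i) * Phi `|x i - wmean x p|
  + (m * support_defect f Phi (wmean x p) s (wmean x q)
  + \sum_(i < n) (p i - m * q i) * support_defect f Phi (wmean x p) s (x i)).
Proof.
have aE i : p i - m * q i = 1 * p i + - m * q i by ring.
rewrite sum_support_defect {1}/support_defect.
have -> : \sum_(i < n) (p i - m * q i) = 1 - m.
  by rewrite sumrB -mulr_sumr p1 q1 mulr1.
have -> : wmean x (fun i => p i - m * q i) = wmean x p - m * wmean x q.
  by rewrite /wmean; under eq_bigr do rewrite aE; rewrite sum_lincomb; ring.
have -> : \sum_(i < n) (p i - m * q i) * f (x i) =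
    \sum_(i < n) p i * f (x i) - m * \sum_(i < n) q i * f (x i).
  by under eq_bigr do rewrite aE; rewrite sum_lincomb; ring.
by rewrite /jensen; ring.
Qed.

(** Here the weights [M * q i - p i] at [x i] and 1 at [wmean x p] have total [M] and first moment
    [M * wmean x q]. *)
Lemma jensen_gap_upper (M s : R) :
  M * jensen f x q - jensen f x p =
  \sum_(i < n) (M * q i - p i) * Phi `|x i - wmean x q|
  + Phi `|wmean x q - wmean x p|
  + (support_defect f Phi (wmean x q) s (wmean x p)
  + \sum_(i < n) (M * q i - p i) * support_defect f Phi (wmean x q) s (x i)).
Proof.
have aE i : M * q i - p i = - 1 * p i + M * q i by ring.
rewrite sum_support_defect {1}/support_defect (distrC (wmean x p)).
have -> : \sum_(i < n) (M * q i - p i) = M - 1.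
  by rewrite sumrB -mulr_sumr p1 q1 mulr1.
have -> : wmean x (fun i => M * q i - p i) = M * wmean x q - wmean x p.
  by rewrite /wmean; under eq_bigr do rewrite aE; rewrite sum_lincomb; ring.
have -> : \sum_(i < n) (M * q i - p i) * f (x i) =
    M * \sum_(i < n) q i * f (x i) - \sum_(i < n) p i * f (x i).
  by under eq_bigr do rewrite aE; rewrite sum_lincomb; ring.
by rewrite /jensen; ring.
Qed.

End Barycentre.

(** * Signs of the weights, and reduction to two points *)

Lemma min_ratio_ge0 n (p q : 'I_n.+1 -> R) :
  (forall i, 0 <= p i) -> (forall i, 0 < q i) -> 0 <= min_ratio p q.
Proof.
by move=> p0 q0; apply: le_bigmin => [|i _]; apply: divr_ge0 => //; exact: ltW.
Qed.

Lemma min_ratio_le n (p q : 'I_n.+1 -> R) (i : 'I_n.+1) :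
  0 < q i -> min_ratio p q * q i <= p i.
Proof. by move=> qi; rewrite -ler_pdivlMr //; exact: bigmin_le. Qed.

Lemma le_max_ratio n (p q : 'I_n.+1 -> R) (i : 'I_n.+1) :
  0 < q i -> p i <= max_ratio p q * q i.
Proof.
by move=> qi; rewrite -ler_pdivrMr //; exact: (le_bigmax _ (fun j => p j / q j)).
Qed.

(** With only two ratios, if the first is the minimum then the second dominates both. This is why p2
    / q2 stands for [M] in (D) and (F). *)
Lemma max_ratio_two (p q : 'I_2 -> R) : min_ratio p q = p ord0 / q ord0 ->
  max_ratio p q = p ord_max / q ord_max.
Proof.
move=> mE; have le12 : p ord0 / q ord0 <= p ord_max / q ord_max.
  by rewrite -mE; exact: bigmin_le.
apply/le_anti/andP; split; last first.
  exact: (le_bigmax _ (fun j => p j / q j)).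
apply: bigmax_le => // i _; case: (unliftP ord0 i) => [j ->|-> //].
by rewrite (_ : lift ord0 j = ord_max) //; apply/val_inj; rewrite /= ord1.
Qed.

(* [rel] is [>=] for the inequalities and [=] for their equality case. *)
Lemma two_point_case b (rel : R -> R -> Prop) f Phi (x p q : 'I_2 -> R) :
  let m := min_ratio p q in
  let M := max_ratio p q in
  let xp := wmean x p in
  let xq := wmean x q in
  let x1 := x ord0 in let x2 := x ord_max in
  let p1 := p ord0 in let p2 := p ord_max in
  let q1 := q ord0 in let q2 := q ord_max in
  admissible b x p q -> m = p1 / q1 ->
  rel (jensen f x p - m * jensen f x q)
      (m * Phi `|xq - xp| + \sum_(i < 2) (p i - m * q i) * Phi `|x i - xp|) ->
  rel (M * jensen f x q - jensen f x p)
      (\sum_(i < 2) (M * q i - p i) * Phi `|x i - xq| + Phi `|xq - xp|) ->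
  [/\ rel (jensen f x p - p1 / q1 * jensen f x q)
          (p1 / q1 * Phi `|xq - xp|
           + (p2 - p1 / q1 * q2) * Phi (p1 * `|x2 - x1|)),
      p1 / q1 * Phi `|xq - xp| + (p2 - p1 / q1 * q2) * Phi (p1 * `|x2 - x1|)
      = m * Phi `|xq - xp| + (1 - m) * Phi (p1 * `|x2 - x1|),
      rel (p2 / q2 * jensen f x q - jensen f x p)
          ((p2 / q2 * q1 - p1) * Phi `|q2 * (x2 - x1)| + Phi `|xq - xp|)
    & q1 = 1 / 2 -> q2 = 1 / 2 ->
      rel (jensen f x p
            - 2 * p1 * ((f x1 + f x2) / 2 - f ((x1 + x2) / 2)))
          (2 * p1 * Phi `|(x1 + x2) / 2 - xp|
            + (1 - 2 * p1) * Phi (p1 * `|x2 - x1|)) /\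
      rel (p2 / q2 * ((f x1 + f x2) / 2 - f ((x1 + x2) / 2)) - jensen f x p)
          ((p2 - p1) * Phi `|(x2 - x1) / 2| + Phi `|(x1 + x2) / 2 - xp|)].
Proof.
move=> m M xp xq x1 x2 p1 p2 q1 q2 [_ p0 q0 sp sq] mE.
have sum2 (F : 'I_2 -> R) : \sum_(i < 2) F i = F ord0 + F ord_max.
  by rewrite big_ord_recl big_ord1; congr (_ + F _); apply/val_inj.
have q1n : q1 != 0 by rewrite gt_eqF // q0.
have q2n : q2 != 0 by rewrite gt_eqF // q0.
have p2E : p2 = 1 - p1 by rewrite -sp sum2 addrAC subrr add0r.
have q2E : q2 = 1 - q1 by rewrite -sq sum2 addrAC subrr add0r.
have x2xp : `|x2 - xp| = p1 * `|x2 - x1|.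
  rewrite -[X in X * _]ger0_norm ?p0 // -normrM; congr `|_|.
  by rewrite /xp /wmean sum2 -/p1 -/p2 -/x1 -/x2 p2E; ring.
have x1xq : `|x1 - xq| = `|q2 * (x2 - x1)|.
  rewrite distrC; congr `|_|.
  by rewrite /xq /wmean sum2 -/q1 -/q2 -/x1 -/x2 q2E; ring.
rewrite !sum2 [M](max_ratio_two mE) mE -/p1 -/p2 -/q1 -/q2 -/x1 -/x2 x2xp x1xq.
(* Since m = p1 / q1 and M = p2 / q2, the first weight in (A) and the second in (B) vanish, leaving
   one [Phi] term of each sum. *)
rewrite !divfK // !subrr !mul0r add0r addr0 => C D; split=> //.
  by congr (_ + _ * _); rewrite p2E q2E; field.
move=> q1h q2h.
have xqE : xq = (x1 + x2) / 2.
  by rewrite /xq /wmean sum2 -/q1 -/q2 -/x1 -/x2 q1h q2h; field.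
have JE : jensen f x q = (f x1 + f x2) / 2 - f ((x1 + x2) / 2).
  rewrite /jensen -/xq xqE sum2 -/q1 -/q2 -/x1 -/x2 q1h q2h.
  by congr (_ - _); field.
have p1E : 2 * p1 = p1 / q1 by rewrite q1h; field.
split.
  move: C; rewrite xqE JE p1E.
  by have -> : p2 - p1 / q1 * q2 = 1 - p1 / q1 by rewrite p2E q1h q2h; field.
move: D; rewrite xqE JE.
have -> : p2 / q2 * q1 - p1 = p2 - p1 by rewrite q1h q2h; field.
by have -> : q2 * (x2 - x1) = (x2 - x1) / 2 by rewrite q2h; field.
Qed.

End Support.

Theorem theorem7 (R : realType) (b : \bar R) (b_gt0 : (0 < b)%E) :
  (forall (f Phi : R -> R),
     (forall t, halfopen b t -> 0 <= Phi t) ->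
     continuously_differentiable_on (halfopen b) f ->
     uniformly_convex b Phi f ->
     (* (A) and (B) *)
     (forall (n : nat) (x p q : 'I_n.+1 -> R), admissible b x p q ->
        let m := min_ratio p q in
        let M := max_ratio p q in
        let xp := wmean x p in
        let xq := wmean x q in
        jensen f x p - m * jensen f x q >=
          m * Phi `|xq - xp|
          + \sum_(i < n.+1) (p i - m * q i) * Phi `|x i - xp|
        /\
        M * jensen f x q - jensen f x p >=
          \sum_(i < n.+1) (M * q i - p i) * Phi `|x i - xq|
          + Phi `|xq - xp|) /\
     (* (C), (D), (E) and (F) *)
     (forall (x p q : 'I_2 -> R), admissible b x p q ->
        let m := min_ratio p q in
        let xp := wmean x p in
        let xq := wmean x q in
        let x1 := x ord0 in let x2 := x ord_max in
        let p1 := p ord0 in let p2 := p ord_max in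
        let q1 := q ord0 in let q2 := q ord_max in
        m = p1 / q1 ->
        [/\ jensen f x p - p1 / q1 * jensen f x q >=
              p1 / q1 * Phi `|xq - xp|
              + (p2 - p1 / q1 * q2) * Phi (p1 * `|x2 - x1|),
            p1 / q1 * Phi `|xq - xp|
              + (p2 - p1 / q1 * q2) * Phi (p1 * `|x2 - x1|)
            = m * Phi `|xq - xp| + (1 - m) * Phi (p1 * `|x2 - x1|),
            p2 / q2 * jensen f x q - jensen f x p >=
              (p2 / q2 * q1 - p1) * Phi `|q2 * (x2 - x1)| + Phi `|xq - xp|
          & q1 = 1 / 2 -> q2 = 1 / 2 ->
            jensen f x p
              - 2 * p1 * ((f x1 + f x2) / 2 - f ((x1 + x2) / 2)) >=
              2 * p1 * Phi `|(x1 + x2) / 2 - xp|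
              + (1 - 2 * p1) * Phi (p1 * `|x2 - x1|)
            /\
            p2 / q2 * ((f x1 + f x2) / 2 - f ((x1 + x2) / 2))
              - jensen f x p >=
              (p2 - p1) * Phi `|(x2 - x1) / 2|
              + Phi `|(x1 + x2) / 2 - xp|]))
  /\
  (* equality when f = Phi = square *)
  (forall (f Phi : R -> R),
     (forall t, halfopen b t -> f t = t ^+ 2) ->
     (forall t, halfopen b t -> Phi t = t ^+ 2) ->
     (forall (n : nat) (x p q : 'I_n.+1 -> R), admissible b x p q ->
        let m := min_ratio p q in
        let M := max_ratio p q in
        let xp := wmean x p in
        let xq := wmean x q in
        jensen f x p - m * jensen f x q =
          m * Phi `|xq - xp|
          + \sum_(i < n.+1) (p i - m * q i) * Phi `|x i - xp|
        /\
        M * jensen f x q - jensen f x p =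
          \sum_(i < n.+1) (M * q i - p i) * Phi `|x i - xq|
          + Phi `|xq - xp|) /\
     (forall (x p q : 'I_2 -> R), admissible b x p q ->
        let m := min_ratio p q in
        let xp := wmean x p in
        let xq := wmean x q in
        let x1 := x ord0 in let x2 := x ord_max in
        let p1 := p ord0 in let p2 := p ord_max in
        let q1 := q ord0 in let q2 := q ord_max in
        m = p1 / q1 ->
        [/\ jensen f x p - p1 / q1 * jensen f x q =
              p1 / q1 * Phi `|xq - xp|
              + (p2 - p1 / q1 * q2) * Phi (p1 * `|x2 - x1|),
            p1 / q1 * Phi `|xq - xp|
              + (p2 - p1 / q1 * q2) * Phi (p1 * `|x2 - x1|)
            = m * Phi `|xq - xp| + (1 - m) * Phi (p1 * `|x2 - x1|),
            p2 / q2 * jensen f x q - jensen f x p =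
              (p2 / q2 * q1 - p1) * Phi `|q2 * (x2 - x1)| + Phi `|xq - xp|
          & q1 = 1 / 2 -> q2 = 1 / 2 ->
            jensen f x p
              - 2 * p1 * ((f x1 + f x2) / 2 - f ((x1 + x2) / 2)) =
              2 * p1 * Phi `|(x1 + x2) / 2 - xp|
              + (1 - 2 * p1) * Phi (p1 * `|x2 - x1|)
            /\
            p2 / q2 * ((f x1 + f x2) / 2 - f ((x1 + x2) / 2))
              - jensen f x p =
              (p2 - p1) * Phi `|(x2 - x1) / 2|
              + Phi `|(x1 + x2) / 2 - xp|])).
Proof.
split=> f Phi.
- move=> _ [df [dfP _]] uc.
  (* (A) and (B) come first for all sizes, because the two-point statements are derived from their
     instance at [n = 1]. *)
  have AB (n : nat) (x p q : 'I_n.+1 -> R) : admissible b x p q ->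
      let m := min_ratio p q in
      let M := max_ratio p q in
      let xp := wmean x p in
      let xq := wmean x q in
      jensen f x p - m * jensen f x q >=
        m * Phi `|xq - xp|
        + \sum_(i < n.+1) (p i - m * q i) * Phi `|x i - xp| /\
      M * jensen f x q - jensen f x p >=
        \sum_(i < n.+1) (M * q i - p i) * Phi `|x i - xq| + Phi `|xq - xp|.
    move=> [hx p0 q0 sp sq] m M xp xq.
    have hp : halfopen b xp by exact: halfopen_wmean.
    have hq : halfopen b xq.
      by apply: halfopen_wmean => // i; exact: ltW.
    have G c y : halfopen b c -> halfopen b y ->
        0 <= support_defect f Phi c (df c) y.
      by move=> hc; apply: support_defect_ge0 => //; exact: dfP.
    split.
      rewrite (jensen_gap_lower _ f Phi sp sq m (df xp)) lerDl addr_ge0 //.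
        by apply: mulr_ge0; [exact: min_ratio_ge0 | exact: G].
      apply: sumr_ge0 => i _; apply: mulr_ge0; last exact: G.
      by rewrite subr_ge0 min_ratio_le.
    rewrite (jensen_gap_upper _ f Phi sp sq M (df xq)) lerDl addr_ge0 ?G //.
    apply: sumr_ge0 => i _; apply: mulr_ge0; last exact: G.
    by rewrite subr_ge0 le_max_ratio.
  split=> // x p q adm m xp xq x1 x2 p1 p2 q1 q2 mE.
  have [A B] := AB _ x p q adm.
  exact: (two_point_case (rel := fun u v => v <= u) adm mE A B).
- move=> fE PhiE.
  have AB (n : nat) (x p q : 'I_n.+1 -> R) : admissible b x p q ->
      let m := min_ratio p q in
      let M := max_ratio p q in
      let xp := wmean x p in
      let xq := wmean x q in
      jensen f x p - m * jensen f x q =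
        m * Phi `|xq - xp|
        + \sum_(i < n.+1) (p i - m * q i) * Phi `|x i - xp| /\
      M * jensen f x q - jensen f x p =
        \sum_(i < n.+1) (M * q i - p i) * Phi `|x i - xq| + Phi `|xq - xp|.
    move=> [hx p0 q0 sp sq] m M xp xq.
    have hp : halfopen b xp by exact: halfopen_wmean.
    have hq : halfopen b xq.
      by apply: halfopen_wmean => // i; exact: ltW.
    (* The slope is now the explicit 2c, and every defect is zero, so the remainders in both gap
       identities vanish whatever the weights. *)
    have G c y := @support_defect_sqr R b f Phi c y fE PhiE.
    have S0 (a : 'I_n.+1 -> R) c : halfopen b c ->
        \sum_(i < n.+1) a i * support_defect f Phi c (2 * c) (x i) = 0.
      by move=> hc; apply: big1 => i _; rewrite G ?mulr0.
    split.
      rewrite (jensen_gap_lower _ f Phi sp sq m (2 * xp)) S0 // G //.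
      by rewrite mulr0 !addr0.
    by rewrite (jensen_gap_upper _ f Phi sp sq M (2 * xq)) S0 // G // !addr0.
  split=> // x p q adm m xp xq x1 x2 p1 p2 q1 q2 mE.
  have [A B] := AB _ x p q adm.
  exact: (two_point_case (rel := eq) adm mE A B).
Qed.
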